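(* For any pseudo-Finsler manifold $(M,F)$, with $M$ connected, the Finslerian separation $d_F$ is a generalized distance on $M$, the forward open balls $B^+_F(p,r)=\{q\in M:d_F(p,q)<r\}$ (respectively, the backward open balls $B^-_F(p,r)=\{q\in M:d_F(q,p)<r\}$), $p\in M$, $r>0$, generate the topology of the manifold $M$, and $d_F$ is continuous with this topology.
   Context: A pseudo-Finsler metric on a manifold $M$ is a continuous function $F:TM\to[0,\infty)$, smooth away from the zero section, such that $F(v)=0$ iff $v$ is a zero vector and $F(\lambda v)=\lambda F(v)$ for all $\lambda>0$ and $v\in TM$ (no convexity is required, i.e. the fundamental tensor, the fiberwise Hessian of $\frac12F^2$, is not assumed positive definite). The Finslerian separation is $d_F(p,q)=\inf_\alpha\int_a^bF(\dot\alpha(t))\,dt$, the infimum being taken over all piecewise smooth curves $\alpha:[a,b]\to M$ from $p$ to $q$. A generalized distance on a set $X$ is a map $d:X\times X\to\mathbb R$ such that: (a1) $d(x,y)\ge0$ for all $x,y\in X$; (a2) $d(x,y)=d(y,x)=0$ if and only if $x=y$; (a3) $d(x,z)\le d(x,y)+d(y,z)$ for all $x,y,z\in X$; (a4) given a sequence $\{x_n\}\subset X$ and $x\in X$, $\lim_{n\to\infty}d(x_n,x)=0$ if and only if $\lim_{n\to\infty}d(x,x_n)=0$. *)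

(* Defs.v *)
From HB Require Import structures.
From mathcomp Require Import all_boot all_order all_algebra.
From mathcomp Require Import all_classical all_reals all_analysis.
Set Implicit Arguments.
Unset Strict Implicit.
Unset Printing Implicit Defensive.
Import Order.TTheory GRing.Theory Num.Theory.
Import numFieldNormedType.Exports.
Local Open Scope classical_set_scope.
Local Open Scope ring_scope.

Section Smooth.
Context {R : realType} {V W : normedModType R}.

(* On a finite-dimensional V (the only use below) and an open U, this is the
   usual class C^k: f is differentiable on U and each of its directional
   derivatives is of class C^(k-1) on U. *)
Fixpoint Ck (k : nat) (U : set V) (f : V -> W) : Prop :=
  if k is k'.+1 then
    (forall x, U x -> differentiable f x) /\
    (forall v, Ck k' U (fun x => 'D_v f x))
  else forall x, U x -> {for x, continuous f}.

Definition smooth_on (U : set V) (f : V -> W) : Prop := forall k, Ck k U f.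

Lemma smooth_on_diff (U : set V) (f : V -> W) (x : V) :
  smooth_on U f -> U x -> differentiable f x.
Proof. by move=> /(_ 1)[+ _]; apply. Qed.

End Smooth.

Lemma derive_chain (R : realType) (U V W : normedModType R)
    (f : U -> V) (g : V -> W) (h : U -> W) (x u : U) (y : V) :
  f x = y -> differentiable f x -> differentiable g y ->
  (\forall z \near x, h z = g (f z)) ->
  'D_u h x = 'd g y ('d f x u).
Proof.
move=> <- df dg hgf.
rewrite (near_eq_derive _ (hgf : \forall z \near x, h z = (g \o f) z)).
by rewrite deriveE ?(diff_comp df dg) //; exact: differentiable_comp.
Qed.

(* A chart defined on the open set chart_dom; chart_map and chart_inv are total
   functions whose values off chart_dom and off chart_img are irrelevant. *)
Record chart_on (R : realType) (n : nat) (M : topologicalType) := Chart {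
  chart_dom : set M;
  chart_map :> M -> 'rV[R]_n;
  chart_inv : 'rV[R]_n -> M;
  chart_dom_open : open chart_dom;
  chart_img_open : open (chart_map @` chart_dom);
  chart_mapK : forall p, chart_dom p -> chart_inv (chart_map p) = p;
  chart_map_continuous :
    forall p, chart_dom p -> {for p, continuous chart_map};
  chart_inv_continuous :
    forall x, (chart_map @` chart_dom) x -> {for x, continuous chart_inv} }.

Definition chart_img (R : realType) (n : nat) (M : topologicalType)
  (c : chart_on R n M) : set 'rV[R]_n := c @` chart_dom c.

Definition transition (R : realType) (n : nat) (M : topologicalType)
  (c c' : chart_on R n M) : 'rV[R]_n -> 'rV[R]_n := c' \o chart_inv c.

(* A Hausdorff, second countable smooth n-manifold without boundary, whose
   smooth structure is given by a (not necessarily maximal) atlas. *)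
Record manifold (R : realType) (n : nat) := Manifold {
  carrier :> topologicalType;
  chart_index : Type;
  chart : chart_index -> chart_on R n carrier;
  chart_cover : forall p : carrier, exists i, chart_dom (chart i) p;
  transition_smooth : forall i j,
    smooth_on (chart i @` (chart_dom (chart i) `&` chart_dom (chart j)))
      (transition (chart i) (chart j));
  manifold_hausdorff : hausdorff_space carrier;
  manifold_second_countable : @second_countable carrier }.

Section Tangent.
Context {R : realType} {n : nat} {M : manifold R n}.

Definition chart_at (p : M) : chart_index M := projT1 (cid (chart_cover p)).

(* An element of TM: a point p and a family of coordinate vectors, one in each
   chart around p, that transforms under changes of charts by the differential
   of the transition map.  The coordinates in the charts whose domain does not
   contain p carry no information; they are set to 0. *)
Record tangent := Tangent {
  tbase : M;
  tcoord : chart_index M -> 'rV[R]_n;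
  tcoord_out : forall i, ~ chart_dom (chart i) tbase -> tcoord i = 0;
  tcoord_change : forall i j,
    chart_dom (chart i) tbase -> chart_dom (chart j) tbase ->
    tcoord j = 'd (transition (chart i) (chart j)) (chart i tbase) (tcoord i) }.

Definition tzero (v : tangent) : Prop := forall i, tcoord v i = 0.

Lemma transition_diff (i j : chart_index M) (p : M) :
  chart_dom (chart i) p -> chart_dom (chart j) p ->
  differentiable (transition (chart i) (chart j)) (chart i p).
Proof.
by move=> ip jp; apply: smooth_on_diff (transition_smooth i j) _; exists p.
Qed.

Lemma transition_chart (i j : chart_index M) (p : M) :
  chart_dom (chart i) p ->
  transition (chart i) (chart j) (chart i p) = chart j p.
Proof. by move=> ip; rewrite /transition /= chart_mapK. Qed.

Lemma transition_chain (i j k : chart_index M) (p : M) (xi : 'rV[R]_n) :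
  chart_dom (chart i) p -> chart_dom (chart j) p -> chart_dom (chart k) p ->
  'd (transition (chart i) (chart k)) (chart i p) xi =
  'd (transition (chart j) (chart k)) (chart j p)
    ('d (transition (chart i) (chart j)) (chart i p) xi).
Proof.
move=> ip jp kp.
apply: etrans (esym (deriveE xi (transition_diff ip kp))) _.
apply: derive_chain (transition_chart j ip) _ _ _; [exact: transition_diff..|].
have ci : {for chart i p, continuous (chart_inv (chart i))}.
  by apply: chart_inv_continuous; exists p.
have : \forall x \near chart i p, chart_dom (chart j) (chart_inv (chart i) x).
  apply: ci; rewrite chart_mapK //.
  by apply: open_nbhs_nbhs; split => //; exact: chart_dom_open.
by apply: filterS => x jx; rewrite /transition /= chart_mapK.
Qed.

(* The tangent vector at p with coordinates xi in the chart i; the zero vector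
   at p if p does not belong to the domain of that chart. *)
Definition tvec_coord (i : chart_index M) (p : M) (xi : 'rV[R]_n)
    (j : chart_index M) : 'rV[R]_n :=
  if `[< chart_dom (chart i) p /\ chart_dom (chart j) p >]
  then 'd (transition (chart i) (chart j)) (chart i p) xi else 0.

Lemma tvec_out (i : chart_index M) (p : M) (xi : 'rV[R]_n) j :
  ~ chart_dom (chart j) p -> tvec_coord i p xi j = 0.
Proof. by move=> jp; rewrite /tvec_coord asboolF // => -[]. Qed.

Lemma tvec_change (i : chart_index M) (p : M) (xi : 'rV[R]_n) j k :
  chart_dom (chart j) p -> chart_dom (chart k) p ->
  tvec_coord i p xi k =
  'd (transition (chart j) (chart k)) (chart j p) (tvec_coord i p xi j).
Proof.
move=> jp kp; rewrite /tvec_coord.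
have [ip|nip] := pselect (chart_dom (chart i) p).
  by rewrite !asboolT //; exact: transition_chain.
by rewrite !asboolF ?linear0 // => -[].
Qed.

Definition tvec (i : chart_index M) (p : M) (xi : 'rV[R]_n) : tangent :=
  Tangent (@tvec_out i p xi) (@tvec_change i p xi).

Lemma tscale_out (a : R) (v : tangent) j :
  ~ chart_dom (chart j) (tbase v) -> a *: tcoord v j = 0.
Proof. by move=> jp; rewrite tcoord_out // scaler0. Qed.

Lemma tscale_change (a : R) (v : tangent) j k :
  chart_dom (chart j) (tbase v) -> chart_dom (chart k) (tbase v) ->
  a *: tcoord v k =
  'd (transition (chart j) (chart k)) (chart j (tbase v)) (a *: tcoord v j).
Proof. by move=> jp kp; rewrite linearZ /= -tcoord_change. Qed.

Definition tscale (a : R) (v : tangent) : tangent :=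
  @Tangent (tbase v) (fun i => a *: tcoord v i)
    (@tscale_out a v) (@tscale_change a v).

End Tangent.

Arguments tangent {R n} M.

(* f : TM -> R read in the chart of TM induced by the chart i of M. *)
Definition local_rep (R : realType) (n : nat) (M : manifold R n)
    (f : tangent M -> R) (i : chart_index M) (z : 'rV[R]_n * 'rV[R]_n) : R :=
  f (tvec i (chart_inv (chart i) z.1) z.2).

Record pseudo_finsler (R : realType) (n : nat) (M : manifold R n) :=
    PseudoFinsler {
  finsler_fun :> tangent M -> R;
  finsler_ge0 : forall v, 0 <= finsler_fun v;
  finsler_continuous : forall i (z : 'rV[R]_n * 'rV[R]_n),
    chart_img (chart i) z.1 -> {for z, continuous (local_rep finsler_fun i)};
  finsler_smooth : forall i,
    smooth_on [set z : 'rV[R]_n * 'rV[R]_n |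
               chart_img (chart i) z.1 /\ z.2 != 0]
      (local_rep finsler_fun i : _ -> R^o);
  finsler_eq0 : forall v, finsler_fun v = 0 <-> tzero v;
  finsler_homogeneous : forall (a : R) v, 0 < a ->
    finsler_fun (tscale a v) = a * finsler_fun v }.

Section Curves.
Context {R : realType} {n : nat} {M : manifold R n}.

Definition smooth_curve_on (O : set R) (c : R -> M) : Prop :=
  (forall t, O t -> {for t, continuous c}) /\
  (forall i, smooth_on (O `&` c @^-1` chart_dom (chart i))
               (chart i \o c : R^o -> 'rV[R]_n)).

(* Smoothness on a closed interval means: restriction of a curve that is smooth
   on an open set containing the interval. *)
Definition smooth_curve_itv (a b : R) (c : R -> M) : Prop :=
  exists (O : set R) (c' : R -> M),
    [/\ open O, `[a, b] `<=` O, smooth_curve_on O c' &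
        forall t, t \in `[a, b] -> c t = c' t].

(* a :: s lists the subdivision points; itv_partition says that it increases
   strictly from a to b. *)
Definition piecewise_smooth (a b : R) (c : R -> M) : Prop :=
  exists2 s : seq R, itv_partition a b s &
    forall k, (k < size s)%N ->
      smooth_curve_itv (nth b (a :: s) k) (nth b (a :: s) k.+1) c.

(* Meaningful where c is differentiable; for a piecewise smooth c this excludes
   only a finite set of parameters, which the integral below ignores. *)
Definition velocity (c : R -> M) (t : R) : tangent M :=
  let i := chart_at (c t) in tvec i (c t) (derive1 (chart i \o c) t).

Lemma velocityE (c : R -> M) (t : R) (i : chart_index M) :
  {for t, continuous c} -> chart_dom (chart i) (c t) ->
  differentiable (chart (chart_at (c t)) \o c : R^o -> 'rV[R]_n) t ->
  differentiable (chart i \o c : R^o -> 'rV[R]_n) t ->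
  tcoord (velocity c t) i = derive1 (chart i \o c) t.
Proof.
move=> ct ip dc di.
have jp : chart_dom (chart (chart_at (c t))) (c t).
  exact: (projT2 (cid (chart_cover (c t)))).
rewrite /velocity /= /tvec_coord asboolT //.
set j := chart_at (c t) in dc jp *.
rewrite (derive1E' dc) derive1E; symmetry.
apply: (derive_chain (f := chart j \o c : R^o -> 'rV[R]_n)) => //.
  exact: transition_diff.
have : \forall s \near t, chart_dom (chart j) (c s).
  by apply: ct; apply: open_nbhs_nbhs; split => //; exact: chart_dom_open.
by apply: filterS => s js; rewrite /transition /= chart_mapK.
Qed.

Definition curve_length (F : pseudo_finsler M) (a b : R) (c : R -> M) : \bar R :=
  (\int[lebesgue_measure]_(t in `[a, b]) (F (velocity c t))%:E)%E.

(* Extended-real valued, so that finiteness is not built into the definition: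
   the infimum is +oo if no piecewise smooth curve joins p to q. *)
Definition finsler_separation (F : pseudo_finsler M) (p q : M) : \bar R :=
  ereal_inf [set l | exists (a b : R) (c : R -> M),
    [/\ a < b, piecewise_smooth a b c, c a = p, c b = q &
        l = curve_length F a b c]].

Definition finsler_dist (F : pseudo_finsler M) (p q : M) : R :=
  fine (finsler_separation F p q).

Definition forward_ball (F : pseudo_finsler M) (p : M) (r : R) : set M :=
  [set q | finsler_dist F p q < r].

Definition backward_ball (F : pseudo_finsler M) (p : M) (r : R) : set M :=
  [set q | finsler_dist F q p < r].

End Curves.

Record generalized_distance (R : realType) (X : Type) (d : X -> X -> R) : Prop :=
    GeneralizedDistance {
  gdist_ge0 : forall x y, 0 <= d x y;
  gdist_eq0 : forall x y, d x y = 0 /\ d y x = 0 <-> x = y;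
  gdist_triangle : forall x y z, d x z <= d x y + d y z;
  gdist_cvg : forall (u : nat -> X) (x : X),
    (d (u k) x @[k --> \oo] --> (0 : R)) <->
    (d x (u k) @[k --> \oo] --> (0 : R)) }.

(* Main.v *)
Require Import Defs.
From HB Require Import structures.
From mathcomp Require Import all_boot all_order all_algebra.
From mathcomp Require Import all_classical all_reals all_analysis.
From mathcomp Require Import measurable_realfun lra.
Set Implicit Arguments.
Unset Strict Implicit.
Unset Printing Implicit Defensive.
Import Order.TTheory GRing.Theory Num.Theory.
Import numFieldNormedType.Exports.
Local Open Scope classical_set_scope.
Local Open Scope ring_scope.

(* Near a point p, in a chart, compactness of (closed ball) x (unit sphere) and
   homogeneity give m |v| <= F(x, v) <= K |v|.  The upper bound applied to
   straight segments shows that d(p, q) and d(q, p) are small when q is close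
   to p.  The lower bound shows that every curve, in either direction, between
   p and a point outside a given neighborhood of p has length bounded below by
   some e > 0: the coordinate distance to p, truncated at the radius of a small
   closed ball and constant off that ball, is defined on all of M and changes
   along a curve by at most 1/m times its length.  Together with the triangle
   inequality (concatenation of curves) these two facts give everything;
   connectedness is only used for the finiteness of d. *)

Lemma near_eq_continuous (T U : topologicalType) (f g : T -> U) (t : T) :
  (\forall s \near t, f s = g s) -> {for t, continuous f} ->
  {for t, continuous g}.
Proof.
move=> fg cf; rewrite /prop_for /continuous_at -(nbhs_singleton fg).
by apply: cvg_trans cf; apply: near_eq_cvg; exact: fg.
Qed.

(** * Smooth functions and smooth curves *)

Section CkTheory.
Context {R : realType} {U V W : normedModType R}.

Lemma Ck_subset k (A B : set V) (f : V -> W) : A `<=` B -> Ck k B f -> Ck k A f.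
Proof.
move=> AB; elim: k f => [|k IH] f /=; first by move=> H x /AB /H.
by move=> [df Df]; split=> [x /AB /df //|v]; exact: IH.
Qed.

(** The two difference quotients are the same function of the increment, so [f] may be arbitrary
    here and no chain rule is involved. *)
Lemma derive_comp_affine (f : V -> W) (h : U -> V) (l : U -> V) :
  (forall (a : R) v x, h (a *: v + x) = a *: l v + h x) ->
  forall v x, 'D_v (f \o h) x = 'D_(l v) f (h x).
Proof.
move=> hl v x; rewrite /derive.
suff -> : (fun a : R => a^-1 *: (((f \o h) \o shift x) (a *: v) - (f \o h) x)) =
          (fun a => a^-1 *: ((f \o shift (h x)) (a *: l v) - f (h x))) by [].
by apply/funext => a /=; rewrite hl.
Qed.

(** A directional derivative of [f \o h] is a directional derivative of [f] composed with the same
    [h], which closes the induction on [k]. It covers both reparametrizations used below: time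
    shifts and straight segments. *)
Lemma Ck_comp_affine k (A : set V) (f : V -> W) (h : U -> V) (l : U -> V) :
  (forall x, differentiable h x) ->
  (forall (a : R) v x, h (a *: v + x) = a *: l v + h x) ->
  Ck k A f -> Ck k (h @^-1` A) (f \o h).
Proof.
move=> dh hl; elim: k f => [|k IH] f /=.
  move=> cf x Ax; apply: continuous_comp; last exact: cf.
  exact: differentiable_continuous.
move=> [df Df]; split=> [x Ax|v].
  by apply: differentiable_comp => //; exact: df.
rewrite (_ : (fun x => _) = (fun y => 'D_(l v) f y) \o h); first exact: IH.
by apply/funext => x; rewrite (derive_comp_affine f hl).
Qed.

End CkTheory.

(** * Tangent vectors and velocities read in a chart *)

Section TangentTheory.
Context {R : realType} {n : nat} {M : manifold R n}.

Lemma tangent_eq (v w : tangent M) :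
  tbase v = tbase w -> tcoord v = tcoord w -> v = w.
Proof.
case: v w => [p c o h] [p' c' o' h'] /= pp' cc'; subst p' c'.
by congr Tangent; exact: Prop_irrelevance.
Qed.

Lemma chart_img_dom (i : chart_index M) (x : 'rV[R]_n) :
  chart_img (chart i) x -> chart_dom (chart i) (chart_inv (chart i) x).
Proof. by move=> [p ip <-]; rewrite chart_mapK. Qed.

Lemma chart_invK (i : chart_index M) (x : 'rV[R]_n) :
  chart_img (chart i) x -> chart i (chart_inv (chart i) x) = x.
Proof. by move=> [p ip <-]; rewrite chart_mapK. Qed.

Lemma near_chart_dom (T : topologicalType) (c : T -> M) (t : T) i :
  {for t, continuous c} -> chart_dom (chart i) (c t) ->
  \forall s \near t, chart_dom (chart i) (c s).
Proof.
move=> ct ip; apply: ct; apply: open_nbhs_nbhs.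
by split => //; exact: chart_dom_open.
Qed.

(** Near [chart i p] the transition from the chart to itself is the identity, hence so is its
    differential. *)
Lemma tvec_coordK (i : chart_index M) (p : M) (xi : 'rV[R]_n) :
  chart_dom (chart i) p -> tcoord (tvec i p xi) i = xi.
Proof.
move=> ip; rewrite /= /tvec_coord asboolT //.
rewrite -deriveE; last exact: transition_diff.
rewrite (@near_eq_derive _ _ _ _ id) ?derive_id //.
have : \forall x \near chart i p, chart_img (chart i) x.
  by apply: open_nbhs_nbhs; split; [exact: chart_img_open|exists p].
by apply: filterS => x ix; rewrite /transition /= chart_invK.
Qed.

(** Frees the velocity from the arbitrary choice made by [chart_at]: any chart around [c t] computes
    it. *)
Lemma velocity_tvec (c : R -> M) (t : R) (i : chart_index M) :
  {for t, continuous c} -> chart_dom (chart i) (c t) ->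
  (forall j, chart_dom (chart j) (c t) ->
    differentiable (chart j \o c : R^o -> 'rV[R]_n) t) ->
  velocity c t = tvec i (c t) (derive1 (chart i \o c) t).
Proof.
move=> ct ip dc; apply: tangent_eq => //; apply/funext => j.
have [jp|njp] := pselect (chart_dom (chart j) (c t)); last first.
  by rewrite !tcoord_out.
rewrite [LHS](tcoord_change (t := velocity c t) (i := i)) //.
rewrite velocityE //; first by rewrite /= /tvec_coord asboolT.
- by apply: dc; exact: (projT2 (cid (chart_cover (c t)))).
- exact: dc.
Qed.

Lemma near_eq_velocity (c c' : R -> M) (t : R) :
  (\forall s \near t, c s = c' s) -> velocity c t = velocity c' t.
Proof.
move=> cc'; have ctt : c t = c' t by exact: nbhs_singleton cc'.
rewrite /velocity ctt; congr tvec; rewrite !derive1E.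
by apply: near_eq_derive; apply: filterS cc' => s /= ->.
Qed.

Lemma velocity_shift (c : R -> M) (k t : R) :
  velocity (fun s => c (s + k)) t = velocity c (t + k).
Proof.
rewrite /velocity; congr tvec; rewrite /derive1.
by under eq_fun do rewrite /= -addrA.
Qed.

End TangentTheory.

Section SmoothCurves.
Context {R : realType} {n : nat} {M : manifold R n}.
Variables (O : set R) (c : R -> M).
Hypotheses (oO : open O) (sc : smooth_curve_on O c).

Lemma smooth_curve_differentiable (t : R) i : O t -> chart_dom (chart i) (c t) ->
  differentiable (chart i \o c : R^o -> 'rV[R]_n) t.
Proof. by move=> Ot ip; apply: smooth_on_diff (sc.2 i) _. Qed.

Lemma smooth_curve_near (t : R) i : O t -> chart_dom (chart i) (c t) ->
  \forall s \near t, O s /\ chart_dom (chart i) (c s).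
Proof.
move=> Ot ip; apply: filterI; first exact: open_nbhs_nbhs.
exact: (near_chart_dom (sc.1 _ Ot) ip).
Qed.

Lemma smooth_curve_derive1_continuous (t : R) i :
  O t -> chart_dom (chart i) (c t) ->
  {for t, continuous (derive1 (chart i \o c))}.
Proof.
move=> Ot ip; have [_ /(_ 1) /= D] := sc.2 i 1%N.
rewrite (_ : derive1 _ = fun x : R^o => 'D_1 (chart i \o c) x); first exact: D.
by apply/funext => s; rewrite derive1E.
Qed.

Lemma smooth_curve_velocity (t : R) i : O t -> chart_dom (chart i) (c t) ->
  velocity c t = tvec i (c t) (derive1 (chart i \o c) t).
Proof.
move=> Ot ip; apply: velocity_tvec => //; first exact: sc.1.
by move=> j jp; exact: smooth_curve_differentiable.
Qed.

Lemma local_rep_velocity (F : pseudo_finsler M) (t : R) i :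
  O t -> chart_dom (chart i) (c t) ->
  F (velocity c t) = local_rep F i (chart i (c t), derive1 (chart i \o c) t).
Proof.
by move=> Ot ip; rewrite (smooth_curve_velocity Ot ip) /local_rep /= chart_mapK.
Qed.

(** In one fixed chart around [c t] the speed is the local representation of [F] along the
    continuous pair (position, derivative). Continuity of [F] at zero vectors covers the times at
    which the velocity vanishes. *)
Lemma speed_continuous (F : pseudo_finsler M) (t : R) :
  O t -> {for t, continuous (fun s => F (velocity c s))}.
Proof.
move=> Ot; have [i ip] := chart_cover (c t).
apply: (near_eq_continuous (f := fun s => local_rep F i
   (chart i (c s), derive1 (chart i \o c) s))).
  apply: filterS (smooth_curve_near Ot ip) => s [Os ips].
  by rewrite (local_rep_velocity F Os ips).
apply: (@continuous_comp _ _ _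
  (fun s => (chart i (c s), derive1 (chart i \o c) s)) (local_rep F i)).
  have cx : {for t, continuous (chart i \o c)}.
    exact: (differentiable_continuous (smooth_curve_differentiable Ot ip)).
  exact: (cvg_pair cx (smooth_curve_derive1_continuous Ot ip)).
by apply: finsler_continuous; exists (c t).
Qed.

End SmoothCurves.

(** * Lengths of piecewise smooth curves *)

Section LebesgueIntervals.
Context {R : realType}.
Notation mu := (@lebesgue_measure R).
Local Open Scope ereal_scope.

Lemma measurable_shift (k : R) :
  measurable_fun setT (fun t : measurableTypeR R => (t + k)%R : measurableTypeR R).
Proof.
suff : measurable_fun setT (fun t : R => (t + k)%R) by [].
apply: continuous_measurable_fun => t.
by apply: continuousD; [exact: cvg_id|exact: cvg_cst].
Qed.

(** By uniqueness of the Lebesgue measure it is enough to compare the measures of half-open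
    intervals. *)
Lemma lebesgue_measure_shift (k : R) (A : set R) : measurable A ->
  pushforward mu (fun t : measurableTypeR R => (t + k)%R : measurableTypeR R) A = mu A.
Proof.
move=> mA; apply/esym/lebesgue_measure_unique => //=.
  exact: measurable_shift.
move=> _ _ [[a b]] _ <-; rewrite /pushforward /=.
rewrite (_ : (fun t : R => _) @^-1` _ = `](a - k)%R, (b - k)%R]%classic).
  rewrite !lebesgue_measure_itv /= !lte_fin ltrD2r; case: ifP => // _.
  by rewrite -!EFinD opprB addrA subrK.
by apply/seteqP; split => t /=; rewrite !in_itv /= ltrBlDr lerBrDr.
Qed.

Lemma ge0_integral_shift (a b k : R) (f : R -> \bar R) :
  measurable_fun `[(a + k)%R, (b + k)%R] f -> (forall t, 0 <= f t) ->
  \int[mu]_(t in `[(a + k)%R, (b + k)%R]) f t =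
  \int[mu]_(t in `[a, b]) f (t + k)%R.
Proof.
move=> mf f0; rewrite (_ : `[a, b]%classic =
    (fun t : measurableTypeR R => (t + k)%R : measurableTypeR R) @^-1` `[(a + k)%R, (b + k)%R]).
  rewrite -[RHS](ge0_integral_pushforward (measurable_shift k) mu) //=.
  apply: eq_measure_integral => //=; first exact: measurable_shift.
  by move=> _ A mA _; exact/esym/lebesgue_measure_shift.
by apply/seteqP; split => t /=; rewrite !in_itv /= !lerD2r.
Qed.

Lemma ge0_integral_itv_split (a w b : R) (f : R -> \bar R) :
  (a <= w <= b)%R -> measurable_fun `[a, b] f -> (forall t, 0 <= f t) ->
  \int[mu]_(t in `[a, b]) f t =
  \int[mu]_(t in `[a, w]) f t + \int[mu]_(t in `[w, b]) f t.
Proof.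
move=> /andP[aw wb] mf f0.
(* The second piece is open at [w] to make the union disjoint; the null set {w} is put back at the
   end. *)
have e : `[a, b]%classic = `[a, w]%classic `|` `]w, b]%classic.
  by rewrite -itv_bndbnd_setU // bnd_simp.
rewrite e ge0_integral_setU //; first 1 last.
- by rewrite -e.
- apply/disj_setPS => t [] /=; rewrite !in_itv /= => /andP[_ tw] /andP[wt _].
  by move: (lt_le_trans wt tw); rewrite ltxx.
congr (_ + _); apply: integral_itv_obnd_cbnd.
by apply: measurable_funS mf => //; apply: subset_itvr; rewrite bnd_simp.
Qed.

Lemma measurable_fun_itv_split (a w b : R) (f : R -> \bar R) :
  (a <= w <= b)%R -> measurable_fun `[a, w] f -> measurable_fun `[w, b] f ->
  measurable_fun `[a, b] f.
Proof.
move=> /andP[aw wb] mf mg.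
rewrite (_ : `[a, b]%classic = `[a, w]%classic `|` `[w, b]%classic).
  by apply/measurable_funU.
apply/seteqP; split => t /=; rewrite !in_itv /=.
  by move=> /andP[-> ->]; rewrite andbT; apply/orP; exact: le_total.
by move=> [] /andP[at_ tb]; apply/andP; split=> //;
  [exact: le_trans tb wb|exact: le_trans aw at_].
Qed.

End LebesgueIntervals.

(** * Piecewise smooth curves, piece by piece *)

Section PiecewiseSmooth.
Context {R : realType} {n : nat} {M : manifold R n}.

Implicit Types (c : R -> M) (a b k : R).

(** This form, without a list of subdivision points, allows induction on the smooth pieces. *)
Inductive pw_smooth (c : R -> M) : R -> R -> Prop :=
| pw_smooth1 a b : a < b -> smooth_curve_itv a b c -> pw_smooth c a b
| pw_smoothS a w b : a < w -> smooth_curve_itv a w c -> pw_smooth c w b ->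
    pw_smooth c a b.

Lemma pw_smooth_lt c a b : pw_smooth c a b -> a < b.
Proof. by elim=> // {}a w {}b aw _ _; exact: lt_trans. Qed.

(** The condition [a < b] excludes the empty subdivision, which is a partition only when the
    endpoints agree. *)
Lemma piecewise_smoothP c a b :
  a < b /\ piecewise_smooth a b c <-> pw_smooth c a b.
Proof.
split=> [[ab [s]]|].
  elim: s a ab => [|w s IH] a ab.
    by move=> /itv_partition_nil E; rewrite E ltxx in ab.
  move=> asb H; have aw : a < w by case: asb => /= /andP[].
  have aws : smooth_curve_itv a w c by exact: (H 0%N).
  have wsb := itv_partition_cons asb.
  case: s IH asb H wsb => [|w' s] IH asb H wsb.
    by rewrite -(itv_partition_nil wsb); exact: pw_smooth1.
  apply: pw_smoothS aw aws _; apply: IH => //; last by move=> k; exact: (H k.+1).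
  case: wsb => /= /andP[ww' ps] /eqP <-.
  apply: lt_le_trans ww' _.
  have /allP ms := order_path_min lt_trans ps.
  have := mem_last w' s; rewrite inE => /orP[/eqP -> //|ls].
  exact/ltW/ms.
elim=> {a b} [a b ab sab|a w b aw saw wb [_ [s [ps /eqP ls] H]]].
  split=> //; exists [:: b]; first exact: itv_partition1.
  by case.
split; first exact: lt_trans (pw_smooth_lt wb).
exists (w :: s); first by split; rewrite /= ?aw ?ls.
by case=> [|k] /= ks //; exact: H.
Qed.

Lemma pw_smooth_trans c a w b :
  pw_smooth c a w -> pw_smooth c w b -> pw_smooth c a b.
Proof.
elim=> {a w} [a w aw saw wb|a v w av sav _ IH wb].
  exact: pw_smoothS saw wb.
by apply: pw_smoothS sav _ => //; exact: IH.
Qed.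

Lemma smooth_curve_itv_eq c c' a b : (forall t, t \in `[a, b] -> c t = c' t) ->
  smooth_curve_itv a b c -> smooth_curve_itv a b c'.
Proof.
move=> cc' [U [d [oU abU sd cd]]]; exists U, d; split => // t tab.
by rewrite -cc' // cd.
Qed.

Lemma smooth_curve_shift O (c : R -> M) (k : R) :
  smooth_curve_on O c ->
  smooth_curve_on [set t | O (t + k)] (fun t => c (t + k)).
Proof.
move=> [cc sc]; split=> [t Ot|i m].
  apply: (@continuous_comp _ _ _ (fun s : R => s + k) c); last exact: cc.
  by apply: continuousD; [exact: cvg_id|exact: cvg_cst].
apply: (@Ck_comp_affine _ R^o R^o _ m
  (O `&` c @^-1` chart_dom (chart i)) (chart i \o c) (fun t : R^o => t + k) id).
- by move=> x; apply: differentiableD.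
- by move=> x v y; rewrite addrA.
- exact: sc.
Qed.

Lemma smooth_curve_itv_shift c a b k : smooth_curve_itv (a + k) (b + k) c ->
  smooth_curve_itv a b (fun t => c (t + k)).
Proof.
move=> [U [d [oU abU sd cd]]].
exists [set t | U (t + k)], (fun t => d (t + k)); split.
- apply: (@open_comp _ _ (fun t : R => t + k)) => // t _.
  by apply: continuousD; [exact: cvg_id|exact: cvg_cst].
- by move=> t /=; rewrite in_itv /= => tab; apply: abU; rewrite /= in_itv /= !lerD2r.
- exact: smooth_curve_shift.
- by move=> t; rewrite in_itv /= => tab; apply: cd; rewrite in_itv /= !lerD2r.
Qed.

Lemma pw_smooth_eq c c' a b : (forall t, t \in `[a, b] -> c t = c' t) ->
  pw_smooth c a b -> pw_smooth c' a b.
Proof.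
move=> + pc; elim: pc => {a b} [a b ab sab|a w b aw saw wb IH] cc'.
  by apply: pw_smooth1 ab _; exact: smooth_curve_itv_eq cc' sab.
have wltb := pw_smooth_lt wb.
apply: (pw_smoothS aw); last first.
  apply: IH => t; rewrite in_itv /= => /andP[wt tb]; apply: cc'.
  by rewrite in_itv /= tb (le_trans (ltW aw) wt).
apply: smooth_curve_itv_eq saw => t; rewrite in_itv /= => /andP[wt tb].
by apply: cc'; rewrite in_itv /= wt (le_trans tb (ltW wltb)).
Qed.

Lemma pw_smooth_shift c a b k : pw_smooth c (a + k) (b + k) ->
  pw_smooth (fun t => c (t + k)) a b.
Proof.
move ea : (a + k) => a'; move eb : (b + k) => b' pc.
elim: pc a b ea eb => {a' b'} [a' b' ab sab|a' w b' aw saw wb IH] a b ea eb.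
  apply: pw_smooth1; first by rewrite -ea -eb ltrD2r in ab.
  by apply: smooth_curve_itv_shift; rewrite ea eb.
apply: (@pw_smoothS _ _ (w - k)); first by rewrite ltrBrDr ea.
  by apply: smooth_curve_itv_shift; rewrite ea subrK.
by apply: IH => //; rewrite subrK.
Qed.

End PiecewiseSmooth.

(** * Lengths of curves and the triangle inequality *)

Section Length.
Context {R : realType} {n : nat} {M : manifold R n} (F : pseudo_finsler M).
Notation mu := (@lebesgue_measure R).

(** Only interior times qualify: the velocity at an endpoint also depends on values of the curve
    outside the interval. Measurability and length ignore the two endpoints. *)
Lemma near_itv_eq_velocity (c c' : R -> M) a b :
  (forall t, t \in `[a, b] -> c t = c' t) ->
  forall t, t \in `]a, b[ -> velocity c t = velocity c' t.
Proof.
move=> cc' t tab; apply: near_eq_velocity.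
apply: filterS (near_in_itvoo tab) => s sab.
by apply: cc'; move: sab; exact: subset_itv_oo_cc.
Qed.

Lemma smooth_speed_measurable O (c : R -> M) a b :
  open O -> smooth_curve_on O c -> `[a, b] `<=` O ->
  measurable_fun `[a, b] (fun t => F (velocity c t)).
Proof.
move=> oO sc abO; apply: subspace_continuous_measurable_fun => //.
apply: continuous_subspace_itv => t tab.
by apply: (speed_continuous oO sc); exact: abO.
Qed.

Lemma itv_eq_measurable_speed (c c' : R -> M) a b :
  (forall t, t \in `[a, b] -> c t = c' t) ->
  measurable_fun `[a, b] (fun t => F (velocity c t)) ->
  measurable_fun `[a, b] (fun t => F (velocity c' t)).
Proof.
move=> cc' mc; apply: (@measurable_fun_itv_cc _ _ _ false true).
apply: (@eq_measurable_fun _ _ _ _ _ (fun t => F (velocity c t))).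
  by move=> t; rewrite inE => tab; rewrite (near_itv_eq_velocity cc').
by apply: measurable_funS mc => //; exact: subset_itv_oo_cc.
Qed.

Lemma itv_eq_curve_length (c c' : R -> M) a b :
  (forall t, t \in `[a, b] -> c t = c' t) ->
  measurable_fun `[a, b] (fun t => F (velocity c t)) ->
  curve_length F a b c = curve_length F a b c'.
Proof.
move=> cc' mc; rewrite /curve_length.
rewrite integral_itv_bndoo; last first.
  apply/measurable_EFinP; apply: measurable_funS mc => //.
  exact: subset_itv_oo_cc.
rewrite [RHS]integral_itv_bndoo; last first.
  have mc' := itv_eq_measurable_speed cc' mc.
  apply/measurable_EFinP; apply: measurable_funS mc' => //.
  exact: subset_itv_oo_cc.
apply: eq_integral => t; rewrite inE => tab.
by rewrite (near_itv_eq_velocity cc').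
Qed.

Lemma pw_smooth_measurable_speed (c : R -> M) a b : pw_smooth c a b ->
  measurable_fun `[a, b] (fun t => F (velocity c t)).
Proof.
have H u v : smooth_curve_itv u v c ->
    measurable_fun `[u, v] (fun t => F (velocity c t)).
  move=> [U [d [oU abU sd cd]]].
  apply: itv_eq_measurable_speed (smooth_speed_measurable oU sd abU).
  by move=> t /cd.
elim=> {a b} [a b ab /H //|a w b aw /H saw wb IH].
apply/measurable_EFinP; apply: (@measurable_fun_itv_split _ _ w).
- by rewrite !ltW //; exact: pw_smooth_lt wb.
- exact/measurable_EFinP.
- exact/measurable_EFinP.
Qed.

Lemma curve_length_ge0 a b (c : R -> M) : (0 <= curve_length F a b c)%E.
Proof. by apply: integral_ge0 => t _; rewrite lee_fin finsler_ge0. Qed.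

Lemma curve_length_split (c : R -> M) (a w b : R) : a <= w <= b ->
  measurable_fun `[a, b] (fun t => F (velocity c t)) ->
  curve_length F a b c = (curve_length F a w c + curve_length F w b c)%E.
Proof.
move=> awb mc; apply: ge0_integral_itv_split => //; first exact/measurable_EFinP.
by move=> t; rewrite lee_fin finsler_ge0.
Qed.

Lemma curve_length_shift (c : R -> M) (a b k : R) :
  measurable_fun `[a + k, b + k] (fun t => F (velocity c t)) ->
  curve_length F (a + k) (b + k) c = curve_length F a b (fun t => c (t + k)).
Proof.
move=> /measurable_EFinP mc; have F0 t : (0 <= (F (velocity c t))%:E)%E.
  by rewrite lee_fin finsler_ge0.
have := ge0_integral_shift mc F0; rewrite /curve_length => ->.
by apply: eq_integral => t _; rewrite velocity_shift.
Qed.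

Lemma finsler_separation_lb p q (m : \bar R) :
  (forall a b c, pw_smooth c a b -> c a = p -> c b = q ->
    (m <= curve_length F a b c)%E) ->
  (m <= finsler_separation F p q)%E.
Proof.
move=> H; apply: le_ereal_inf_tmp => _ [a [b [c [ab pc ca cb ->]]]].
by apply: H => //; exact/piecewise_smoothP.
Qed.

Lemma finsler_separation_ub a b c : pw_smooth c a b ->
  (finsler_separation F (c a) (c b) <= curve_length F a b c)%E.
Proof.
move=> /piecewise_smoothP[ab pc]; apply: ereal_inf_lbound.
by exists a, b, c.
Qed.

Lemma finsler_separation_ge0 p q : (0 <= finsler_separation F p q)%E.
Proof. by apply: finsler_separation_lb => *; exact: curve_length_ge0. Qed.

(** Almost minimizing curves from [p] to [q] and from [q] to [r] are concatenated, after a time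
    shift of the second one; lengths add. *)
Lemma finsler_separation_triangle p q r :
  (finsler_separation F p r <=
   finsler_separation F p q + finsler_separation F q r)%E.
Proof.
have H a b c a' b' c' : pw_smooth c a b -> pw_smooth c' a' b' ->
    c a = p -> c b = q -> c' a' = q -> c' b' = r ->
    (finsler_separation F p r <=
     curve_length F a b c + curve_length F a' b' c')%E.
  move=> pc pc' ca cb ca' cb'.
  have ab := pw_smooth_lt pc; have ab' := pw_smooth_lt pc'.
  (* The shift by [k] makes the second curve start at time [b], where the first one stops; it then
     ends at time [e]. *)
  pose k := a' - b; pose e := b' - k.
  have ek : e + k = b' by rewrite subrK.
  have bk : b + k = a' by rewrite addrC subrK.
  have be : b < e by rewrite -(ltrD2r k) ek bk.
  pose d t := if t <= b then c t else c' (t + k).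
  have dc t : t \in `[a, b] -> c t = d t.
    by rewrite in_itv /= => /andP[_ tb]; rewrite /d tb.
  have dc' t : t \in `[b, e] -> c' (t + k) = d t.
    rewrite in_itv /= => /andP[bt _]; rewrite /d; case: ifP => // tb.
    by have -> : t = b; [apply/eqP; rewrite eq_le tb|rewrite bk cb].
  have pck : pw_smooth (fun t => c' (t + k)) b e.
    by apply: pw_smooth_shift; rewrite bk ek.
  have pd : pw_smooth d a e.
    exact: pw_smooth_trans (pw_smooth_eq dc pc) (pw_smooth_eq dc' pck).
  have := finsler_separation_ub pd.
  have -> : d a = p by rewrite /d (ltW ab).
  have -> : d e = r by rewrite /d leNgt be /= ek.
  have mp := pw_smooth_measurable_speed pc.
  have mpk := pw_smooth_measurable_speed pck.
  have md := pw_smooth_measurable_speed pd.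
  have mp' : measurable_fun `[b + k, e + k] (fun t => F (velocity c' t)).
    by rewrite bk ek; exact: pw_smooth_measurable_speed.
  move=> /le_trans; apply.
  rewrite (curve_length_split (w := b) _ md); last by rewrite !ltW.
  rewrite (itv_eq_curve_length dc mp) -(itv_eq_curve_length dc' mpk).
  by have := curve_length_shift mp'; rewrite bk ek => ->.
(* If one term is infinite, so is the sum, because the other term is nonnegative. Otherwise both
   infima can be approached within e / 2. *)
have [->|pq] := eqVneq (finsler_separation F p q) +oo%E.
  by rewrite addye ?leey // gt_eqF // (lt_le_trans _ (finsler_separation_ge0 _ _)).
have [->|qr] := eqVneq (finsler_separation F q r) +oo%E.
  by rewrite addey ?leey // gt_eqF // (lt_le_trans _ (finsler_separation_ge0 _ _)).
apply/lee_addgt0Pr => e e0.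
have e2 : 0 < e / 2 by rewrite divr_gt0.
have near_opt x y : finsler_separation F x y != +oo%E -> exists a b c,
    [/\ pw_smooth c a b, c a = x, c b = y &
     (curve_length F a b c < finsler_separation F x y + (e / 2)%:E)%E].
  move=> xy; have fxy : finsler_separation F x y \is a fin_num.
    by rewrite ge0_fin_numE ?finsler_separation_ge0 // ltey.
  have : (finsler_separation F x y < finsler_separation F x y + (e / 2)%:E)%E.
    by rewrite lteDl // lte_fin.
  move=> /ereal_inf_lt[_ [a [b [c [ab pc ca cb ->]]]] L].
  by exists a, b, c; split=> //; exact/piecewise_smoothP.
have [a [b [c [pc ca cb L]]]] := near_opt _ _ pq.
have [a' [b' [c' [pc' ca' cb' L']]]] := near_opt _ _ qr.
apply: le_trans (H _ _ _ _ _ _ pc pc' ca cb ca' cb') _.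
apply: le_trans (leeD (ltW L) (ltW L')) _.
by rewrite addeACA -EFinD -splitr.
Qed.

End Length.

(** * Comparison with the coordinate norm *)

(** Convexity of balls: the vector from a point of the segment to [x0] is the convex combination of
    the vectors from its two ends. *)
Lemma ball_segment (R : realType) (V : normedModType R) (x0 x y : V) (r t : R) :
  ball x0 r x -> ball x0 r y -> 0 <= t <= 1 -> ball x0 r (x + t *: (y - x)).
Proof.
rewrite -!ball_normE /ball_ /= => xr yr /andP[t0 t1].
have -> : x0 - (x + t *: (y - x)) = (1 - t) *: (x0 - x) + t *: (x0 - y).
  rewrite scalerBl scale1r opprD addrA -[RHS]addrA; congr (_ + _).
  rewrite [RHS]addrC -scalerBr -scalerN; congr (_ *: _).
  by rewrite !opprB [RHS]addrC addrA subrK.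
apply: le_lt_trans (ler_normD _ _) _; rewrite !normrZ.
rewrite (ger0_norm t0) ger0_norm ?subr_ge0 //.
set m := Num.max `|x0 - x| `|x0 - y|.
have mr : m < r by rewrite /m gt_max xr yr.
apply: le_lt_trans mr; rewrite -[leRHS]mul1r -[X in X * m](subrK t) [leRHS]mulrDl.
by apply: lerD; apply: ler_wpM2l; rewrite ?subr_ge0 // le_max lexx ?orbT.
Qed.

Lemma differentiable_segment (R : realType) (V : normedModType R) (x u : V) (t : R^o) :
  differentiable (fun s : R^o => x + s *: u : V) t.
Proof. by apply: differentiableD. Qed.

Lemma segment_affine (R : realType) (V : normedModType R) (x u : V) (a : R) (s t : R^o) :
  x + (a *: s + t) *: u = a *: (s *: u) + (x + t *: u).
Proof. by rewrite scalerDl scalerA addrCA. Qed.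

Lemma compact_norm_ball (R : realType) (n : nat) (x0 : 'rV[R]_n) (r : R) : 0 < r ->
  compact [set x | `|x0 - x| <= r].
Proof.
move=> r0; have -> : [set x | `|x0 - x| <= r] = closed_ball x0 r by rewrite closed_ballE.
apply: bounded_closed_compact; last exact: closed_ball_closed.
exists (`|x0| + r); split; first exact: num_real.
move=> y yr x; rewrite closed_ballE // => xr; apply: le_trans (ltW yr).
rewrite -lerBlDl; apply: le_trans xr.
by rewrite distrC; exact: lerB_dist.
Qed.

Section LocalRep.
Context {R : realType} {n : nat} {M : manifold R n} (F : pseudo_finsler M).
Variable i : chart_index M.

Lemma tvec_scale (p : M) (a : R) (xi : 'rV[R]_n) :
  tvec i p (a *: xi) = tscale a (tvec i p xi).
Proof.
apply: tangent_eq => //=; apply/funext => j; rewrite /tvec_coord.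
by case: ifP => _; [rewrite linearZ|rewrite scaler0].
Qed.

Lemma local_rep_scale (x v : 'rV[R]_n) (a : R) : 0 < a ->
  local_rep F i (x, a *: v) = a * local_rep F i (x, v).
Proof. by move=> a0; rewrite /local_rep /= tvec_scale finsler_homogeneous. Qed.

Lemma local_rep0 (x : 'rV[R]_n) : local_rep F i (x, 0) = 0.
Proof.
apply/finsler_eq0 => j; rewrite /= /tvec_coord.
by case: ifP => _ //; exact: linear0.
Qed.

Lemma local_rep_gt0 (x v : 'rV[R]_n) : chart_img (chart i) x -> v != 0 ->
  0 < local_rep F i (x, v).
Proof.
move=> ix v0; rewrite lt_neqAle finsler_ge0 andbT eq_sym.
apply: contra_neq v0 => /finsler_eq0/(_ i).
by rewrite tvec_coordK //; exact: chart_img_dom.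
Qed.

(** Continuity at the zero vector over [x0] gives F < 1 on a product neighborhood, and homogeneity
    spreads this bound to all vectors. *)
Lemma local_rep_upper (x0 : 'rV[R]_n) : chart_img (chart i) x0 ->
  exists r K : R, [/\ 0 < r, 0 < K, ball x0 r `<=` chart_img (chart i) &
    forall x v, ball x0 r x -> local_rep F i (x, v) <= K * `|v|].
Proof.
move=> ix0.
have : \forall z \near (x0, 0 : 'rV[R]_n), local_rep F i z < 1.
  have Fc := @finsler_continuous _ _ _ F i (x0, 0) ix0.
  by apply: (cvgr_lt (local_rep F i (x0, 0)) Fc); rewrite local_rep0.
move=> /nbhs_ballP[r /= r0 Hr].
have /nbhs_ballP[s /= s0 Hs] : nbhs x0 (chart_img (chart i)).
  by apply: open_nbhs_nbhs; split => //; exact: chart_img_open.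
exists (Num.min r s), (2 / r); split.
- by rewrite lt_min r0.
- by rewrite divr_gt0.
- move=> x xr; apply: Hs; apply: le_ball xr; by rewrite ge_min lexx orbT.
move=> x v xr; have [->|v0] := eqVneq v 0; first by rewrite local_rep0 normr0 mulr0.
have nv : 0 < `|v| by rewrite normr_gt0.
(* Rescales [v] to norm r / 2, inside the neighborhood where F < 1; then F(x, v) < 1 / a, which is
   the announced bound. *)
pose a := r / 2 / `|v|.
have a0 : 0 < a by rewrite !divr_gt0.
have -> : 2 / r * `|v| = a^-1 by rewrite /a !invf_div mulrC mulrA.
rewrite -[leRHS]mulr1 -ler_pdivrMl ?invr_gt0 // invrK -local_rep_scale //.
apply/ltW/Hr; split => /=.
  by apply: le_ball xr; rewrite ge_min lexx.
rewrite -ball_normE /ball_ /= sub0r normrN normrZ gtr0_norm //.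
by rewrite /a divfK ?gt_eqF // ltr_pdivrMr // ltr_pMr // ltr1n.
Qed.

(** On the compact product of a closed ball and the unit sphere, [F] attains a minimum, positive
    since [F] vanishes only at zero vectors; homogeneity does the rest. The bound [e] on the radius
    lets the ball fit into a prescribed neighborhood. *)
Lemma local_rep_lower (x0 : 'rV[R]_n) : chart_img (chart i) x0 ->
  forall e : R, 0 < e ->
  exists r m : R, [/\ 0 < r <= e, 0 < m,
    [set x | `|x0 - x| <= r] `<=` chart_img (chart i) &
    forall x v, `|x0 - x| <= r -> m * `|v| <= local_rep F i (x, v)].
Proof.
move=> ix0 e e0.
have /nbhs_ballP[s /= s0 Hs] : nbhs x0 (chart_img (chart i)).
  by apply: open_nbhs_nbhs; split => //; exact: chart_img_open.
pose r := Num.min e (s / 2).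
have r0 : 0 < r by rewrite lt_min e0 divr_gt0.
pose C := [set x | `|x0 - x| <= r]; pose S := [set v : 'rV[R]_n | `|v| = 1].
have Cimg : C `<=` chart_img (chart i).
  move=> x xr; apply: Hs; rewrite -ball_normE /ball_ /=.
  apply: le_lt_trans xr _; rewrite gt_min; apply/orP; right.
  by rewrite ltr_pdivrMr // ltr_pMr // ltr1n.
suff [m [m0 Hm]] : exists m, 0 < m /\ forall x v, C x -> S v -> m <= local_rep F i (x, v).
  exists r, m; split => //; first by rewrite r0 ge_min lexx.
  move=> x v xr; have [->|v0] := eqVneq v 0; first by rewrite local_rep0 normr0 mulr0.
  have nv : 0 < `|v| by rewrite normr_gt0.
  have := Hm x (`|v|^-1 *: v) xr.
  rewrite local_rep_scale ?invr_gt0 // mulrC ler_pdivlMr //; apply.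
  by rewrite /S /= normrZ gtr0_norm ?invr_gt0 // mulVf // gt_eqF.
(* In dimension 0 the unit sphere is empty, there is no minimum to take, and any positive constant
   will do. *)
have [[v Sv]|S0] := pselect (S !=set0); last first.
  by exists 1; split=> // x v _ Sv; case: S0; exists v.
have cC : compact C by exact: compact_norm_ball.
have cS : compact S.
  apply: bounded_closed_compact.
    exists 1; split; first exact: num_real.
    by move=> y y1 x /= ->; exact: ltW.
  apply: (@closed_comp _ _ _ [set 1 : R]); last exact: closed_eq.
  by move=> x _; exact: norm_continuous.
have [||[x w]] := @compact_EVT_min _ R (local_rep F i) (C `*` S) _ (compact_setX cC cS).
- by exists (x0, v); split => //=; rewrite /C /= subrr normr0 ltW.
- apply: continuous_in_subspaceT => -[x w]; rewrite inE => -[/= Cx _].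
  by apply: finsler_continuous; exact: Cimg.
rewrite inE => -[/= Cx Sw] Hm; exists (local_rep F i (x, w)); split.
  apply: local_rep_gt0; first exact: Cimg.
  by rewrite -normr_gt0 Sw.
by move=> y u Cy Su; apply: Hm; rewrite inE.
Qed.

(** The straight coordinate segment stays in the ball and has constant coordinate velocity y - x, so
    its speed is at most K |y - x| over a unit of time. *)
Lemma segment_length_le (x0 x y : 'rV[R]_n) (r K : R) : 0 <= K ->
  ball x0 r `<=` chart_img (chart i) ->
  (forall x v, ball x0 r x -> local_rep F i (x, v) <= K * `|v|) ->
  ball x0 r x -> ball x0 r y ->
  (finsler_separation F (chart_inv (chart i) x) (chart_inv (chart i) y)
   <= (K * `|y - x|)%:E)%E.
Proof.
move=> K0 rimg HK xr yr; set u := y - x.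
pose l (t : R^o) := x + t *: u.
have lcont t : {for t, continuous l}.
  exact: differentiable_continuous (differentiable_segment x u t).
pose c t := chart_inv (chart i) (l t).
(* Smoothness on [0, 1] asks for an open set of times around it: all times at which the line is
   inside the chart image. *)
pose U := [set t : R | chart_img (chart i) (l t)].
have oU : open U.
  apply: (@open_comp _ _ l); last exact: chart_img_open.
  by move=> t _; exact: lcont.
have lr t : t \in `[0, 1] -> ball x0 r (l t).
  by rewrite in_itv /=; exact: ball_segment.
have sc : smooth_curve_on U c.
  split=> [t Ut|j m].
    by apply: continuous_comp (lcont t) _; exact: chart_inv_continuous.
  (* Read in the chart [j], the curve is a transition map composed with the affine map [l]. *)
  apply: (Ck_subset (B := l @^-1`
      (chart i @` (chart_dom (chart i) `&` chart_dom (chart j))))).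
    move=> t [[p ip pt] jt]; exists p => //; split => //.
    by move: jt; rewrite /c /= -pt chart_mapK.
  apply: (@Ck_comp_affine _ R^o _ _ _ _ (transition (chart i) (chart j)) l
     (fun t => t *: u)).
  - by move=> t; exact: differentiable_segment.
  - by move=> a s t; exact: segment_affine.
  - exact: transition_smooth.
have subU : `[0, 1] `<=` U by move=> t /lr /rimg.
have speed t : t \in `[0, 1] -> F (velocity c t) <= K * `|u|.
  move=> t01; have Ut := subU _ t01.
  have it : chart_dom (chart i) (c t) by exact: chart_img_dom.
  rewrite (local_rep_velocity sc F Ut it) /c chart_invK //.
  suff -> : derive1 (chart i \o c) t = u by apply: HK; exact: lr.
  rewrite derive1E (@near_eq_derive _ _ _ _ (id \o l)).
    rewrite (derive_comp_affine id (segment_affine x u)).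
    by rewrite derive_id scale1r.
  have : \forall s \near t, U s by exact: open_nbhs_nbhs.
  by apply: filterS => s Us /=; rewrite /c chart_invK.
have pc : pw_smooth c 0 1 by apply: pw_smooth1 => //; exists U, c.
have -> : x = l 0 by rewrite /l scale0r addr0.
have -> : y = l 1 by rewrite /l scale1r addrC subrK.
apply: le_trans (finsler_separation_ub F pc) _.
have I1 : (\int[lebesgue_measure]_(t in `[0%R, 1%R]) cst (K * `|u|)%:E t =
    (K * `|u|)%:E :> \bar R)%E.
  by rewrite integral_cst //= lebesgue_measure_itv /= lte_fin ltr01 -EFinB subr0 mule1.
have /measurable_EFinP mF := pw_smooth_measurable_speed F pc.
rewrite -[leRHS]I1; apply: ge0_le_integral => //.
by move=> t _; rewrite lee_fin finsler_ge0.
Qed.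

End LocalRep.

(** * Length of the curves leaving a neighborhood *)

(** Continuous induction: the supremum [T] of the times [t] with [P a t] is itself such a time, and
    it could be passed if it were less than [b]. *)
Lemma itv_local_to_global (R : realType) (P : R -> R -> Prop) (a b : R) : a <= b ->
  (forall u w v, a <= u -> u <= w -> w <= v -> v <= b ->
    P u w -> P w v -> P u v) ->
  (forall t, a <= t <= b -> exists2 e, 0 < e &
    forall u v, a <= u -> u <= v -> v <= b -> `|t - u| < e -> `|t - v| < e ->
      P u v) ->
  P a b.
Proof.
move=> ab Ptrans Ploc.
pose A := [set t | a <= t <= b /\ P a t].
have Aa : A a.
  split; first by rewrite lexx.
  have [|e e0 He] := Ploc a; first by rewrite lexx.
  by apply: He; rewrite ?lexx // subrr normr0.
have Aub : has_sup A by split; [exists a|exists b => t [/andP[]]].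
pose T := sup A.
have aT : a <= T by apply: sup_upper_bound.
have Tb : T <= b by apply: ge_sup; [exists a|move=> t [/andP[]]].
have [|e e0 He] := Ploc T; first by rewrite aT.
(* A good time [t] within [e] of [T]: the local property at [T] leads from [t] to any [s] slightly
   beyond [T]. *)
have [t [/andP[at_ tb] Pat] Tt] := sup_adherent e0 Aub.
have tT : t <= T by apply: sup_upper_bound => //; split=> //; rewrite at_.
have near_T s : T <= s -> s < T + e -> s <= b -> P a s.
  move=> Ts sT sb; apply: (Ptrans _ t) => //; first exact: le_trans tT Ts.
  apply: He => //; first exact: le_trans tT Ts.
    by rewrite ger0_norm ?subr_ge0 // ltrBlDr -ltrBlDl.
  by rewrite distrC ger0_norm ?subr_ge0 // ltrBlDl.
have [Tltb|bT] := ltP T b; last first.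
  have -> : b = T by apply/eqP; rewrite eq_le bT.
  by apply: near_T => //; rewrite ltrDl.
pose s := Num.min b (T + e / 2).
have Ts : T < s by rewrite lt_min Tltb ltrDl divr_gt0.
have sb : s <= b by rewrite ge_min lexx.
have sTe : s < T + e.
  by rewrite gt_min ltrD2l ltr_pdivrMr // ltr_pMr // ltr1n orbT.
have : A s.
  by split; [rewrite (le_trans aT (ltW Ts))|apply: near_T => //; exact: ltW].
by move=> /(sup_upper_bound Aub); rewrite leNgt Ts.
Qed.

Lemma derive1_coord (R : realType) (n : nat) (f : R^o -> 'rV[R]_n) (t : R) k :
  differentiable f t ->
  derivable (fun s : R^o => f s 0 k : R^o) t 1 /\
  derive1 (fun s => f s 0 k) t = derive1 f t 0 k.
Proof.
move=> /derivable1_diffP df.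
have df' : h^-1 *: ((fun s => f s 0 k) (h *: (1 : R^o) + t) - f t 0 k) @[h --> 0^']
    --> (derive1 f t 0 k : R^o).
  rewrite derive1E.
  have := cvg_comp _ (fun N : 'rV[R]_n => N 0 k) df
    (@coord_continuous R 1 n 0 k ('D_1 f t)).
  apply: cvg_trans; apply: near_eq_cvg; apply: nearW => h /=.
  by rewrite !mxE.
split; first by apply/cvg_ex; eexists; exact: df'.
by rewrite derive1E; exact: cvg_lim df'.
Qed.

Section FTCBound.
Context {R : realType}.
Notation mu := (@lebesgue_measure R).

(** The fundamental theorem of calculus bounds the increment of [g] by the integral of |g'|. The
    case u = v is separate because that theorem is applied on a nondegenerate interval. *)
Lemma ftc_norm_le (g f : R -> R) (m u v : R) : u <= v -> 0 <= m ->
  (forall t, t \in `[u, v] -> derivable (g : R^o -> R^o) t 1) ->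
  (forall t, t \in `[u, v] -> {for t, continuous (derive1 g)}) ->
  measurable_fun `[u, v] f ->
  (forall t, t \in `[u, v] -> m * `|derive1 g t| <= f t) ->
  ((m * `|g v - g u|)%:E <= \int[mu]_(t in `[u, v]) (f t)%:E)%E.
Proof.
rewrite le_eqVlt => /predU1P[<-|uv] m0 dg cg mf gf.
  by rewrite subrr normr0 mulr0 set_itv1 integral_set1.
have gcont t : t \in `[u, v] -> {for t, continuous g}.
  by move=> tuv; apply/differentiable_continuous/derivable1_diffP/dg.
have wcg : {within `[u, v], continuous (derive1 g)} by exact: continuous_subspace_itv.
have mg : measurable_fun `[u, v] (derive1 g).
  exact: subspace_continuous_measurable_fun.
have FTC := @continuous_FTC2 R (derive1 g) g u v uv wcg.
have {}FTC : (\int[mu]_(t in `[u, v]) (derive1 g t)%:E = (g v)%:E - (g u)%:E)%E.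
  apply: FTC => //; split.
  - by move=> t tuv; apply: dg; exact: subset_itv_oo_cc.
  - by apply/cvg_at_right_filter/gcont; rewrite in_itv /= lexx ltW.
  - by apply/cvg_at_left_filter/gcont; rewrite in_itv /= lexx ltW.
have mgE : measurable_fun `[u, v] (fun t => (derive1 g t)%:E) by exact/measurable_EFinP.
have := le_abse_integral mu (measurable_itv `[u, v]) mgE.
rewrite FTC -EFinB /= EFinM => H.
apply: (@le_trans _ _ (m%:E * \int[mu]_(t in `[u, v]) `|(derive1 g t)%:E|)%E).
  by apply: lee_wpmul2l => //; rewrite lee_fin.
rewrite -ge0_integralZl_EFin //; last exact: measurableT_comp.
apply: ge0_le_integral => //.
- by move=> t _; rewrite -EFinM lee_fin mulr_ge0.
- by apply/measurable_EFinP; apply: measurable_funM => //; exact: measurableT_comp.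
- by have /measurable_EFinP := mf.
Qed.

End FTCBound.

Lemma ler_coord_norm (R : realType) (m n : nat) (N : 'M[R]_(m, n)) i j :
  `|N i j| <= `|N|.
Proof.
by rewrite [leRHS]/Num.Def.normr /= mx_normrE; apply/bigmax_geP; right; exists (i, j).
Qed.

Section LowerBound.
Context {R : realType} {n : nat} {M : manifold R n} (F : pseudo_finsler M).
Variables (i : chart_index M) (x0 : 'rV[R]_n) (r m : R).
Hypotheses (r0 : 0 < r) (m0 : 0 < m).
Hypothesis rimg : [set x | `|x0 - x| <= r] `<=` chart_img (chart i).
Hypothesis mF : forall x v, `|x0 - x| <= r -> m * `|v| <= local_rep F i (x, v).

(** The gap between [s] and [r] leaves room: a curve at a point of the ball of radius [s] stays for
    a while where [mF] applies. *)
Let s : R := r / 2.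

Let s0 : 0 < s. Proof. by rewrite divr_gt0. Qed.

Let sr : s < r. Proof. by rewrite ltr_pdivrMr // ltr_pMr // ltr1n. Qed.

Definition chart_ball : set M :=
  [set p | chart_dom (chart i) p /\ `|x0 - chart i p| <= s].

(* Since chart_ball is closed, every point has a neighborhood on which this
   function is either constant or 1-Lipschitz in the coordinates. *)
Definition truncated_dist (p : M) : R :=
  if `[< chart_dom (chart i) p >] then Num.min s `|x0 - chart i p| else s.

Lemma truncated_dist_out p : ~ chart_ball p -> truncated_dist p = s.
Proof.
rewrite /truncated_dist => np; case: asboolP => // ip.
by apply/min_idPl; rewrite leNgt; apply/negP => /ltW px; apply: np.
Qed.

(** It is the image of a compact coordinate ball under the continuous inverse chart, and compact
    sets are closed in the Hausdorff space [M]. *)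
Lemma closed_chart_ball : closed chart_ball.
Proof.
have -> : chart_ball = chart_inv (chart i) @` [set x | `|x0 - x| <= s].
  apply/seteqP; split=> [p [ip px]|_ [x xs <-]].
    by exists (chart i p) => //; rewrite chart_mapK.
  have ix : chart_img (chart i) x by apply: rimg; exact: le_trans xs (ltW sr).
  by split; [exact: chart_img_dom|rewrite chart_invK].
apply: compact_closed; first exact: manifold_hausdorff.
apply: continuous_compact; last exact: compact_norm_ball.
apply: continuous_in_subspaceT => x; rewrite inE /= => xs.
by apply: chart_inv_continuous; apply: rimg; exact: le_trans xs (ltW sr).
Qed.

Lemma truncated_dist_lipschitz p q :
  chart_dom (chart i) p -> chart_dom (chart i) q ->
  `|truncated_dist p - truncated_dist q| <= `|chart i p - chart i q|.
Proof.
move=> ip iq; rewrite /truncated_dist !asboolT //.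
have H (a b : R) : `|Num.min s a - Num.min s b| <= `|a - b|.
  rewrite /Num.min; case: ltP => sa; case: ltP => sb; rewrite ?subrr ?normr0 //.
  - rewrite !ger0_norm ?subr_ge0 ?(le_trans sb (ltW sa)) //.
    by rewrite lerB // ltW.
  - rewrite distrC [leRHS]distrC !ger0_norm ?subr_ge0 ?(le_trans sa (ltW sb)) //.
    by rewrite lerB // ltW.
apply: le_trans (H _ _) _; apply: le_trans (ler_dist_dist _ _) _.
have -> : x0 - chart i p - (x0 - chart i q) = chart i q - chart i p.
  by rewrite opprB addrC addrA subrK.
by rewrite distrC.
Qed.

(** The norm of row vectors is the maximum norm, so that of the displacement is attained at one
    coordinate [k], and the scalar estimate for that coordinate suffices. *)
Lemma chart_curve_length_ge O (c : R -> M) u v : open O -> smooth_curve_on O c ->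
  u <= v -> `[u, v] `<=` O ->
  (forall t, t \in `[u, v] ->
    chart_dom (chart i) (c t) /\ `|x0 - chart i (c t)| <= r) ->
  ((m * `|chart i (c v) - chart i (c u)|)%:E <= curve_length F u v c)%E.
Proof.
move=> oO sc uv uvO cr.
have [->|] := eqVneq (chart i (c v) - chart i (c u)) 0.
  by rewrite normr0 mulr0 curve_length_ge0.
rewrite -normr_eq0 => /mx_norm_neq0[[a k] /= E].
have {a E} -> : `|chart i (c v) - chart i (c u)| =
    `|chart i (c v) 0 k - chart i (c u) 0 k|.
  by move: E; rewrite (ord1 a) !mxE.
have dc t : t \in `[u, v] -> differentiable (chart i \o c : R^o -> 'rV[R]_n) t.
  by move=> tuv; apply: (smooth_curve_differentiable sc (uvO _ tuv)); case: (cr _ tuv).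
apply: (@ftc_norm_le _ (fun t => chart i (c t) 0 k)) => //; first exact: ltW.
- by move=> t /dc /derive1_coord -/(_ k)[].
- move=> t tuv.
  have Ot := uvO _ tuv; have [it tr] := cr _ tuv.
  apply: (near_eq_continuous (f := fun t => derive1 (chart i \o c) t 0 k)).
    apply: filterS (smooth_curve_near oO sc Ot it) => w [Ow iw].
    have dw := smooth_curve_differentiable sc Ow iw.
    by have [_ <-] := derive1_coord k dw.
  apply: (@continuous_comp _ _ _ (derive1 (chart i \o c)) (fun N : 'rV[R]_n => N 0 k)).
    exact: (smooth_curve_derive1_continuous sc Ot it).
  exact: coord_continuous.
- exact: (smooth_speed_measurable F oO sc uvO).
move=> t tuv; have Ot := uvO _ tuv; have [it tr] := cr _ tuv.
rewrite (local_rep_velocity sc F Ot it); apply: le_trans (mF _ tr).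
have [_ ->] := derive1_coord k (dc _ tuv).
apply: ler_wpM2l; first exact: ltW.
exact: ler_coord_norm.
Qed.

(** The estimate passes to adjacent intervals, as lengths add and the absolute value is subadditive;
    it thus has to be checked only near each time. *)
Lemma truncated_dist_length_smooth O (c : R -> M) a b :
  open O -> smooth_curve_on O c -> a <= b -> `[a, b] `<=` O ->
  ((m * `|truncated_dist (c b) - truncated_dist (c a)|)%:E <=
   curve_length F a b c)%E.
Proof.
move=> oO sc ab abO.
pose P u v := ((m * `|truncated_dist (c v) - truncated_dist (c u)|)%:E <=
   curve_length F u v c)%E.
apply: (@itv_local_to_global _ P) => // [u w v au uw wv vb Puw Pwv|t tab].
  have uvO : `[u, v] `<=` O.
    move=> z /=; rewrite in_itv /= => /andP[uz zv]; apply: abO.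
    by rewrite /= in_itv /= (le_trans au uz) (le_trans zv vb).
  rewrite /P (curve_length_split (w := w)) ?uw //; last first.
    exact: (smooth_speed_measurable F oO sc uvO).
  apply: le_trans (leeD Puw Pwv); rewrite -EFinD lee_fin -mulrDr.
  apply: ler_wpM2l; first exact: ltW.
  by rewrite [leRHS]addrC; apply: ler_distD.
have Ot : O t by apply: abO; rewrite /= in_itv.
have ct : {for t, continuous c} by exact: sc.1.
(* From a point of the closed ball, the curve stays for a while in the chart at distance less than
   [r], where the coordinate estimate holds. Off the ball, which is closed, the truncated distance
   is locally constant along the curve. *)
have [[it ts]|tout] := pselect (chart_ball (c t)).
  have near_r : \forall w \near t, chart_dom (chart i) (c w) /\ `|x0 - chart i (c w)| < r.
    apply: filterI; first exact: (near_chart_dom ct it).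
    have cic : {for t, continuous (chart i \o c)}.
      exact: (differentiable_continuous (smooth_curve_differentiable sc Ot it)).
    have : `|x0 - chart i (c w)| @[w --> t] --> `|x0 - chart i (c t)|.
      by apply: cvg_norm; apply: cvgB; [exact: cvg_cst|exact: cic].
    by move=> /cvgr_lt; apply; exact: le_lt_trans ts sr.
  have [e /= e0 He] := (nbhs_ballP _ _).1 near_r.
  exists e => // u v au uv vb tu tv.
  have uvr w : w \in `[u, v] -> chart_dom (chart i) (c w) /\ `|x0 - chart i (c w)| <= r.
    rewrite in_itv /= => /andP[uw wv].
    have [//|iw /ltW //] := He w.
    rewrite /ball /= ltr_norml; move: tu tv; rewrite !ltr_norml.
    move=> /andP[_ tu] /andP[tv _]; apply/andP; split.
      by apply: lt_le_trans tv _; rewrite lerB.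
    by apply: le_lt_trans tu; rewrite lerB.
  have [iu _] : chart_dom (chart i) (c u) /\ `|x0 - chart i (c u)| <= r.
    by apply: uvr; rewrite in_itv /= lexx.
  have [iv _] : chart_dom (chart i) (c v) /\ `|x0 - chart i (c v)| <= r.
    by apply: uvr; rewrite in_itv /= lexx uv.
  have uvO : `[u, v] `<=` O.
    move=> z /=; rewrite in_itv /= => /andP[uz zv]; apply: abO.
    by rewrite /= in_itv /= (le_trans au uz) (le_trans zv vb).
  apply: le_trans (chart_curve_length_ge oO sc uv uvO uvr).
  rewrite lee_fin; apply: ler_wpM2l; first exact: ltW.
  exact: truncated_dist_lipschitz.
have near_out : \forall w \near t, ~ chart_ball (c w).
  have oC : open (~` chart_ball) by apply: closed_openC; exact: closed_chart_ball.
  exact: (ct _ (open_nbhs_nbhs (conj oC tout))).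
have [e /= e0 He] := (nbhs_ballP _ _).1 near_out.
exists e => // u v au uv vb tu tv.
rewrite /P !truncated_dist_out; [|exact: He|exact: He].
by rewrite subrr normr0 mulr0 curve_length_ge0.
Qed.

Lemma truncated_dist_length (c : R -> M) a b : pw_smooth c a b ->
  ((m * `|truncated_dist (c b) - truncated_dist (c a)|)%:E <=
   curve_length F a b c)%E.
Proof.
have H u v : u < v -> smooth_curve_itv u v c ->
    ((m * `|truncated_dist (c v) - truncated_dist (c u)|)%:E <=
     curve_length F u v c)%E.
  move=> uv [U [d [oU uvU sd cd]]].
  have dc t : t \in `[u, v] -> d t = c t by move=> /cd.
  have mc := smooth_speed_measurable F oU sd uvU.
  rewrite -(itv_eq_curve_length dc mc).
  have <- : d u = c u by apply: dc; rewrite in_itv /= lexx ltW.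
  have <- : d v = c v by apply: dc; rewrite in_itv /= lexx ltW.
  exact: truncated_dist_length_smooth oU sd (ltW uv) uvU.
elim=> {a b} [a b ab sab|a w b aw saw wb IH]; first exact: H.
have wltb := pw_smooth_lt wb.
have mc := pw_smooth_measurable_speed F (pw_smoothS aw saw wb).
rewrite (curve_length_split (w := w) _ mc); last by rewrite !ltW.
apply: le_trans (leeD (H _ _ aw saw) IH); rewrite -EFinD lee_fin -mulrDr.
apply: ler_wpM2l; first exact: ltW.
by rewrite [leRHS]addrC; apply: ler_distD.
Qed.

Lemma finsler_separation_ge_truncated p q :
  ((m * `|truncated_dist q - truncated_dist p|)%:E <= finsler_separation F p q)%E.
Proof.
by apply: finsler_separation_lb => a b c pc <- <-; exact: truncated_dist_length.
Qed.

(** The truncated distance is 0 at the center [p] and [s] at [q]; the absolute value in the bound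
    serves both directions. *)
Lemma finsler_separation_out p q : chart_dom (chart i) p -> chart i p = x0 ->
  ~ chart_ball q ->
  ((m * s)%:E <= finsler_separation F p q)%E /\
  ((m * s)%:E <= finsler_separation F q p)%E.
Proof.
move=> ip px nq.
have tp : truncated_dist p = 0.
  rewrite /truncated_dist asboolT // px subrr normr0; apply/min_idPr; exact: ltW.
have tq := truncated_dist_out nq.
have s0' := ltW s0.
split; apply: le_trans (finsler_separation_ge_truncated _ _);
  by rewrite tp tq ?sub0r ?subr0 ?normrN ger0_norm.
Qed.

End LowerBound.

(** * The topology of the separation *)

Section CompatibleDistance.
Context {R : realType} {T : topologicalType} (d : T -> T -> R).
Hypothesis hT : hausdorff_space T.
Hypothesis d_ge0 : forall x y, 0 <= d x y.
Hypothesis d_triangle : forall x y z, d x z <= d x y + d y z.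
Hypothesis d_near : forall x (e : R), 0 < e ->
  \forall y \near x, d x y < e /\ d y x < e.
Hypothesis d_away : forall x N, nbhs x N ->
  exists2 e, 0 < e & forall y, ~ N y -> e <= d x y /\ e <= d y x.

Let d_refl x : d x x = 0.
Proof.
apply/eqP; rewrite eq_le d_ge0 andbT; apply/ler_addgt0Pl => e e0.
by rewrite addr0; have [/ltW] := nbhs_singleton (d_near x e0).
Qed.

(** This equivalence and its mirror image reduce both sides of (a4) to convergence in the
    topology. *)
Let d_cvgl (u : nat -> T) x : d (u k) x @[k --> \oo] --> (0 : R) <-> u @ \oo --> x.
Proof.
split=> [du N Nx|ux].
  have [e e0 He] := d_away Nx.
  have : \forall k \near \oo, d (u k) x < e by exact: cvgr_lt du _ e0.
  apply: filterS => k dk; apply: contrapT => /He[_].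
  by rewrite leNgt dk.
apply/cvgr0Pnorm_lt => e e0.
have : \forall k \near \oo, d x (u k) < e /\ d (u k) x < e by exact: (ux _ (d_near x e0)).
by apply: filterS => k [_]; rewrite ger0_norm.
Qed.

Let d_cvgr (u : nat -> T) x : d x (u k) @[k --> \oo] --> (0 : R) <-> u @ \oo --> x.
Proof.
split=> [du N Nx|ux].
  have [e e0 He] := d_away Nx.
  have : \forall k \near \oo, d x (u k) < e by exact: cvgr_lt du _ e0.
  apply: filterS => k dk; apply: contrapT => /He[].
  by rewrite leNgt dk.
apply/cvgr0Pnorm_lt => e e0.
have : \forall k \near \oo, d x (u k) < e /\ d (u k) x < e by exact: (ux _ (d_near x e0)).
by apply: filterS => k []; rewrite ger0_norm.
Qed.

(** For (a2): if d x y = 0, then [d_away] puts [y] in every neighborhood of [x], and the Hausdorff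
    property gives x = y. *)
Lemma compatible_generalized_distance : generalized_distance d.
Proof.
split=> // [x y|u x]; last by rewrite d_cvgl d_cvgr.
split=> [[dxy _]|->]; last by rewrite d_refl.
apply: hT => A B Ax By; exists y; split; last exact: nbhs_singleton.
apply: contrapT => nAy; have [e e0 /(_ y nAy)[]] := d_away Ax.
by rewrite dxy leNgt e0.
Qed.

(** Balls are open by [d_near] at [q] with the slack r - d p q and the triangle inequality; [d_away]
    fits a ball centered at [x] into any neighborhood of [x]. *)
Lemma compatible_forward_basis :
  basis [set B : set T | exists p (r : R), 0 < r /\ B = [set q | d p q < r]].
Proof.
split=> [_ [p [r [r0 ->]]]|x N Nx].
  rewrite openE => q /= pq; have e0 : 0 < r - d p q by rewrite subr_gt0.
  apply: filterS (d_near q e0) => y [qy _].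
  by apply: le_lt_trans (d_triangle p q y) _; rewrite -ltrBrDl.
have [e e0 He] := d_away Nx.
exists [set y | d x y < e]; last first.
  by move=> y /= xy; apply: contrapT => /He[]; rewrite leNgt xy.
by split; [exists x, e|rewrite /= d_refl].
Qed.

Lemma compatible_backward_basis :
  basis [set B : set T | exists p (r : R), 0 < r /\ B = [set q | d q p < r]].
Proof.
split=> [_ [p [r [r0 ->]]]|x N Nx].
  rewrite openE => q /= pq; have e0 : 0 < r - d q p by rewrite subr_gt0.
  apply: filterS (d_near q e0) => y [_ yq].
  by apply: le_lt_trans (d_triangle y q p) _; rewrite -ltrBrDr.
have [e e0 He] := d_away Nx.
exists [set y | d y x < e]; last first.
  by move=> y /= xy; apply: contrapT => /He[_]; rewrite leNgt xy.
by split; [exists x, e|rewrite /= d_refl].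
Qed.

Lemma compatible_continuous : continuous (fun pq : T * T => d pq.1 pq.2).
Proof.
move=> [p q]; apply/cvgrPdist_lt => e e0 /=.
have e2 : 0 < e / 2 by rewrite divr_gt0.
(* Since [d] need not be symmetric, both orders are controlled: d x p and d q y bound d x y from
   above, d p x and d y q bound it from below. *)
exists ([set x | d p x < e / 2 /\ d x p < e / 2],
        [set x | d q x < e / 2 /\ d x q < e / 2]).
  by split; exact: d_near.
move=> [x y] [[/= px xp] [qy yq]]; rewrite /= ltr_norml.
have := d_triangle p x q; have := d_triangle x y q.
have := d_triangle x p y; have := d_triangle p q y.
by move=> *; apply/andP; split; lra.
Qed.

End CompatibleDistance.

(** * Small, large and finite values of the separation *)

Section Separation.
Context {R : realType} {n : nat} {M : manifold R n} (F : pseudo_finsler M).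

Lemma finsler_separation_near (p : M) (e : R) : 0 < e ->
  \forall q \near p, (finsler_separation F p q < e%:E)%E /\
                     (finsler_separation F q p < e%:E)%E.
Proof.
move=> e0; have [i ip] := chart_cover p.
have ix0 : chart_img (chart i) (chart i p) by exists p.
have [r [K [r0 K0 rimg HK]]] := local_rep_upper F ix0.
(* The radius e / K turns the segment bound K |y - x| into a bound by [e], for the segment run in
   either direction. *)
pose s := Num.min r (e / K).
have s0 : 0 < s by rewrite lt_min r0 divr_gt0.
have pr : ball (chart i p) r (chart i p) by exact: ballxx.
have ci : {for p, continuous (chart i)} by exact: chart_map_continuous.
have dp : \forall q \near p, chart_dom (chart i) q.
  by apply: open_nbhs_nbhs; split => //; exact: chart_dom_open.
have bp : \forall q \near p, ball (chart i p) s (chart i q).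
  by apply: ci; exact: nbhsx_ballx.
apply: filterS2 dp bp => q iq qs.
have qr : ball (chart i p) r (chart i q).
  by apply: le_ball qs; rewrite ge_min lexx.
have Ke : K * `|chart i q - chart i p| < e.
  rewrite mulrC -ltr_pdivlMr //; move: qs.
  rewrite -ball_normE /ball_ /= distrC => /lt_le_trans; apply.
  by rewrite ge_min lexx orbT.
have := segment_length_le (ltW K0) rimg HK pr qr.
have := segment_length_le (ltW K0) rimg HK qr pr.
rewrite !chart_mapK // distrC => H1 H2.
by split; [apply: le_lt_trans H2 _|apply: le_lt_trans H1 _]; rewrite lte_fin.
Qed.

Lemma finsler_separation_away (p : M) (N : set M) : nbhs p N ->
  exists2 e : R, 0 < e & forall q, ~ N q ->
    (e%:E <= finsler_separation F p q)%E /\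
    (e%:E <= finsler_separation F q p)%E.
Proof.
move=> Np; have [i ip] := chart_cover p.
have ix0 : chart_img (chart i) (chart i p) by exists p.
have : nbhs (chart i p) (chart_inv (chart i) @^-1` N).
  by apply: chart_inv_continuous => //; rewrite chart_mapK.
move=> /nbhs_ballP[e /= e0 He].
have e2 : 0 < e / 2 by rewrite divr_gt0.
have [r [m [/andP[r0 re] m0 rimg mF]]] := local_rep_lower F ix0 e2.
(* The least length of a curve between [p] and the outside of the ball of radius r / 2, which lies
   in [N] because r <= e / 2. *)
exists (m * (r / 2)); first by rewrite mulr_gt0 // divr_gt0.
move=> q nNq; apply: (finsler_separation_out r0 m0 rimg mF ip) => // -[iq qr].
apply: nNq; rewrite -(chart_mapK iq); apply: He.
rewrite -ball_normE /ball_ /=; apply: le_lt_trans qr _.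
lra.
Qed.

(** The set of points at finite separation from [p] is nonempty, open and closed. *)
Lemma finsler_separation_fin_num (p q : M) : connected [set: M] ->
  finsler_separation F p q \is a fin_num.
Proof.
move=> cM; rewrite ge0_fin_numE ?finsler_separation_ge0 //.
pose A := [set q | (finsler_separation F p q < +oo)%E].
have step x y : A x -> (finsler_separation F x y < 1%:E)%E -> A y.
  move=> Ax xy; apply: le_lt_trans (finsler_separation_triangle F p x y) _.
  by rewrite lte_add_pinfty // (lt_trans xy) // ltry.
suff AT : A = setT by have : [set: M] q by []; rewrite -AT.
have oA : open A.
  rewrite openE => x Ax; apply: filterS (finsler_separation_near x ltr01) => y [xy _].
  exact: step xy.
apply: cM.
- exists p; apply: lt_trans (ltry 1).
  by have [] := nbhs_singleton (finsler_separation_near p ltr01).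
- by exists A; rewrite ?setTI.
(* Closedness uses the other direction of smallness: a point [y] of [A] near [x], with separation
   from [y] to [x] below 1, would put [x] in [A]. *)
exists A; rewrite ?setTI // -[A]setCK; apply: open_closedC.
rewrite openE => x nAx; apply: filterS (finsler_separation_near x ltr01) => y [_ yx].
by move=> Ay; apply: nAx; exact: step yx.
Qed.

End Separation.

Theorem theorem3p15 (R : realType) (n : nat) (M : manifold R n)
    (F : pseudo_finsler M) (M_connected : connected [set: M]) :
  [/\ forall p q : M, finsler_separation F p q \is a fin_num,
      generalized_distance (finsler_dist F),
      basis [set B : set M |
        exists (p : M) (r : R), 0 < r /\ B = forward_ball F p r],
      basis [set B : set M |
        exists (p : M) (r : R), 0 < r /\ B = backward_ball F p r] &
      continuous (fun pq : M * M => finsler_dist F pq.1 pq.2)].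
Proof.
have fin p q := finsler_separation_fin_num F p q M_connected.
(* Finiteness makes [fine] lossless, so the extended-real estimates carry over to the real-valued
   distance. *)
have dE p q : finsler_separation F p q = (finsler_dist F p q)%:E.
  by rewrite /finsler_dist fineK.
have d_ge0 p q : 0 <= finsler_dist F p q.
  by rewrite -lee_fin -dE finsler_separation_ge0.
have d_triangle p q r : finsler_dist F p r <= finsler_dist F p q + finsler_dist F q r.
  by rewrite -lee_fin EFinD -!dE finsler_separation_triangle.
have d_near (p : M) (e : R) : 0 < e ->
    \forall q \near p, finsler_dist F p q < e /\ finsler_dist F q p < e.
  move=> /(finsler_separation_near F p); apply: filterS => q.
  by rewrite !dE !lte_fin.
have d_away (p : M) (N : set M) : nbhs p N ->
    exists2 e, 0 < e & forall q, ~ N q ->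
      e <= finsler_dist F p q /\ e <= finsler_dist F q p.
  move=> /(finsler_separation_away F)[e e0 He]; exists e => // q /He.
  by rewrite !dE !lee_fin.
split=> //.
- exact: compatible_generalized_distance (@manifold_hausdorff _ _ M) _ _ _ _.
- exact: compatible_forward_basis d_ge0 d_triangle d_near d_away.
- exact: compatible_backward_basis d_ge0 d_triangle d_near d_away.
- exact: compatible_continuous.
Qed.
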